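(* Let $1\le m\le n$ and let $K_{m,n}$ be the complete bipartite graph with class sizes $m$ and $n$. Then (a) $rc^\ell(K_{m,n})=n$ if $m=1$, and $rc^\ell(K_{m,n})=\min(\lceil \sqrt[m]{n}\,\rceil,4)$ if $m\ge 2$; (b) $src^\ell(K_{m,n})=\lceil\sqrt[m]{n}\,\rceil$.
   Context: An edge-coloured path is rainbow if all its edges have distinct colours; a geodesic is a shortest path between its endpoints. An (not necessarily proper) edge-colouring of a connected graph is rainbow connected (resp. strongly rainbow connected) if any two vertices are joined by a rainbow path (resp. rainbow geodesic). An $r$-edge-list assignment of $G$ assigns to each edge $e$ a set $L(e)\subset\mathbb N$ with $|L(e)|\ge r$; an $L$-edge-colouring is an edge-colouring $c$ with $c(e)\in L(e)$ for all $e$. $rc^\ell(G)$ (resp. $src^\ell(G)$) is the minimum integer $r$ such that for every $r$-edge-list assignment $L$ of $G$ there exists a rainbow connected (resp. strongly rainbow connected) $L$-edge-colouring of $G$. *)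

(* Defs.v *)
From HB Require Import structures.
From mathcomp Require Import all_boot all_order all_algebra.
From mathcomp Require Import classical_sets cardinality reals exp.

Set Implicit Arguments.
Unset Strict Implicit.
Unset Printing Implicit Defensive.

Import Order.TTheory GRing.Theory Num.Theory.

Record sgraph := SGraph {
  vertex :> finType;
  adj : rel vertex;
  adj_sym : symmetric adj;
  adj_irrefl : irreflexive adj
}.

Definition edges (G : sgraph) : {set {set G}} :=
  [set e : {set G} | [exists x : G, exists y : G, adj x y && (e == [set x; y])]].

(* The path with vertices x :: p, from x to y; its length is size p. *)
Definition gpath (G : sgraph) (x y : G) (p : seq G) : Prop :=
  [/\ path (@adj G) x p, uniq (x :: p) & last x p = y].

Definition path_edges (G : sgraph) (x : G) (p : seq G) : seq {set G} :=
  pairmap (fun u v => [set u; v]) x p.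

Definition geodesic (G : sgraph) (x y : G) (p : seq G) : Prop :=
  gpath x y p /\ forall q : seq G, gpath x y q -> size p <= size q.

(* Edge-colourings and list assignments are functions on all vertex sets, of
   which only the values on edges G are ever used. *)
Definition rainbow (G : sgraph) (c : {set G} -> nat) (x : G) (p : seq G) : Prop :=
  uniq (map c (path_edges x p)).

Definition rainbow_connected (G : sgraph) (c : {set G} -> nat) : Prop :=
  forall x y : G, exists p : seq G, gpath x y p /\ rainbow c x p.

Definition strongly_rainbow_connected (G : sgraph) (c : {set G} -> nat) : Prop :=
  forall x y : G, exists p : seq G, geodesic x y p /\ rainbow c x p.

(* `I_r is {0, ..., r - 1} and #<= compares cardinalities, so the lists have
   at least r elements and may be infinite. *)
Definition edge_list_assignment (G : sgraph) (r : nat)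
    (L : {set G} -> set nat) : Prop :=
  forall e : {set G}, e \in edges G -> (`I_r #<= L e)%card.

Definition list_colouring (G : sgraph) (L : {set G} -> set nat)
    (c : {set G} -> nat) : Prop :=
  forall e : {set G}, e \in edges G -> L e (c e).

Definition is_minimum (P : nat -> Prop) (k : nat) : Prop :=
  P k /\ forall r : nat, P r -> k <= r.

(* is_rcl G k reads "rc^l(G) = k", and is_srcl G k reads "src^l(G) = k". *)
Definition is_rcl (G : sgraph) (k : nat) : Prop :=
  is_minimum (fun r => forall L : {set G} -> set nat,
    edge_list_assignment r L ->
    exists c : {set G} -> nat, list_colouring L c /\ rainbow_connected c) k.

Definition is_srcl (G : sgraph) (k : nat) : Prop :=
  is_minimum (fun r => forall L : {set G} -> set nat,
    edge_list_assignment r L ->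
    exists c : {set G} -> nat,
      list_colouring L c /\ strongly_rainbow_connected c) k.

Definition Kmn_adj (m n : nat) (x y : 'I_m + 'I_n) : bool :=
  match x, y with
  | inl _, inr _ | inr _, inl _ => true
  | _, _ => false
  end.

Lemma Kmn_adj_sym (m n : nat) : symmetric (@Kmn_adj m n).
Proof. by case=> ? [] ?. Qed.

Lemma Kmn_adj_irrefl (m n : nat) : irreflexive (@Kmn_adj m n).
Proof. by case. Qed.

Definition Kmn (m n : nat) : sgraph :=
  SGraph (@Kmn_adj_sym m n) (@Kmn_adj_irrefl m n).

(* Num.ceil is integer-valued; the m-th root is nonnegative, so taking the
   absolute value only casts its ceiling to nat. *)
Definition ceil_root (R : realType) (m n : nat) : nat :=
  `|Num.ceil (powR (n%:R : R) (m%:R : R)^-1)%R|%N.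

(* Main.v *)
Require Import Defs.
From HB Require Import structures.
From mathcomp Require Import all_boot all_order all_algebra.
From mathcomp Require Import classical_sets functions cardinality reals exp.

(** The edges at the [n]-side vertex [j] form a column in [N^m], and two
    [n]-side vertices are joined by a rainbow path of length two iff their
    columns differ.  With constant lists of size [r] there are at most [r^m]
    columns, and with [r <= 3] colours a rainbow path between two [n]-side
    vertices has length two: these are the lower bounds.

    For the upper bounds, the colour at [(i, j)] with [i > j] is always chosen
    different from the one at [(j, j)], which separates the rows because
    [m <= n].  If [n <= r^m], column [j] still has more than [j] candidates
    ([r^m] of them if [m <= j], and at least [2^j] otherwise), so the columns can
    be picked greedily to be distinct.  With lists of size 4 and [2 <= m], let
    column 0 start with [c <> d], and let every other column start with
    [a <> b] outside [{c, d}]: two [n]-side vertices with equal columns are then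
    joined through rows 0, 1 and column 0 by a path coloured [a, c, d, b]. *)

Set Implicit Arguments.
Unset Strict Implicit.
Unset Printing Implicit Defensive.

Import Order.TTheory GRing.Theory Num.Theory.

(** * Preliminaries: roots, distinct representatives, products of lists *)

(** Taking [m]-th powers preserves and reflects the order on nonnegative reals when [0 < m]. The
    real root is thereby traded for an inequality in [nat]. *)
Lemma ceil_root_leq (R : realType) (m n r : nat) :
  0 < m -> (ceil_root R m n <= r) = (n <= r ^ m).
Proof.
move=> m0; rewrite /ceil_root; set x := powR _ _.
have x0 : (0 <= x)%R by exact: powR_ge0.
have xm : (x ^+ m = n%:R)%R.
  by rewrite -powR_mulrn // -powRrM mulVf ?powRr1 ?ler0n // pnatr_eq0 -lt0n.
have c0 : (0 <= Num.ceil x)%R by rewrite ceil_ge0 (lt_le_trans _ x0) // ltrN10.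
rewrite -lez_nat gez0_abs // ceil_le_int -[(r%:~R)%R]/(r%:R)%R.
by rewrite -(ler_pXn2r m0) ?nnegrE ?ler0n // xm -natrX ler_nat.
Qed.

Lemma exists_mem_notin (T : eqType) (s l : seq T) :
  uniq s -> size l < size s -> exists2 x, x \in s & x \notin l.
Proof.
move=> us lt; have /allPn[x xs xl] : ~~ all [in l] s; last by exists x.
by apply/negP => /allP sl; have := uniq_leq_size us sl; rewrite leqNgt lt.
Qed.

(** Choose in increasing order of the index: at index [j] only [j] values are taken, so one of the
    more than [j] candidates is free. *)
Lemma greedy_distinct_representatives (T : eqType) (n : nat)
    (A : 'I_n -> seq T) :
  (forall j, uniq (A j)) -> (forall j : 'I_n, j < size (A j)) ->
  exists2 f : 'I_n -> T, injective f & forall j, f j \in A j.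
Proof.
elim: n A => [|n IHn] A uA sA.
  by have f0 : 'I_0 -> T by [case]; exists f0 => -[].
have [||f fi fA] := IHn (fun j => A (widen_ord (leqnSn n) j)).
- by move=> j; exact: uA.
- by move=> j; exact: (sA (widen_ord (leqnSn n) j)).
have [|x xA xf] := @exists_mem_notin _ _ (codom f) (uA ord_max).
  by rewrite size_codom card_ord; exact: (sA ord_max).
exists (fun j => if unlift ord_max j is Some k then f k else x) => [j k|j].
  case: unliftP => [j'|] ->; case: unliftP => [k'|] -> //.
  - by move=> /fi ->.
  - by move=> fx; rewrite -fx codom_f in xf.
  - by move=> fx; rewrite fx codom_f in xf.
case: unliftP => [k|] -> //.
by have -> : lift ord_max k = widen_ord (leqnSn n) k by exact/val_inj/lift_max.
Qed.

Lemma ffun_product (I : finType) (T : eqType) (S : I -> seq T) :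
  (forall i, uniq (S i)) ->
  exists A : seq {ffun I -> T},
    [/\ uniq A, size A = \prod_i size (S i) &
        forall v, v \in A -> forall i, v i \in S i].
Proof.
move=> uS; pose D := {dffun forall i, 'I_(size (S i))}.
pose F (h : D) : {ffun I -> T} := [ffun i => tnth (in_tuple (S i)) (h i)].
(* Vectors are indexed by positions in the lists, since [T] may be infinite; duplicate-free lists
   make this indexing injective. *)
have Fi : injective F.
  move=> h k /ffunP hk; apply/ffunP => i; have := hk i.
  by rewrite !ffunE => /(tuple_uniqP (in_tuple (S i)) (uS i)).
exists (codom F); split; first exact/injectiveP.
- rewrite size_codom card_dep_ffun foldrE big_map big_enum.
  by apply: eq_bigr => i _; rewrite card_ord.
- move=> _ /codomP[h ->] i; rewrite ffunE.
  exact: (mem_tnth (h i) (in_tuple (S i))).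
Qed.

Lemma card_leII_seq (r : nat) (B : set nat) :
  (`I_r #<= B)%card ->
  exists s : seq nat, [/\ uniq s, size s = r & forall x, x \in s -> B x].
Proof.
move=> /pcard_leP[f]; exists [seq f i | i <- iota 0 r]; split.
- rewrite map_inj_in_uniq ?iota_uniq // => x y.
  rewrite !mem_iota !add0n => xr yr; apply: (@inj _ _ _ f).
  + by rewrite inE.
  + by rewrite inE.
- by rewrite size_map size_iota.
- move=> _ /mapP[i + ->]; rewrite mem_iota add0n => ir.
  exact: (@funS _ _ _ _ f).
Qed.

(** * Edge-colourings of the complete bipartite graph as matrices *)

Definition Kmn_edge (m n : nat) (i : 'I_m) (j : 'I_n) : {set Kmn m n} :=
  [set (inl i : Kmn m n); (inr j : Kmn m n)].

Lemma Kmn_edge_inj (m n : nat) (i i' : 'I_m) (j j' : 'I_n) :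
  Kmn_edge i j = Kmn_edge i' j' -> i = i' /\ j = j'.
Proof.
move=> /setP e; have := e (inl i); have := e (inr j).
by rewrite !inE !eqxx !orbT /= => /esym/eqP[->] /esym/orP[/eqP[->]|].
Qed.

Lemma mem_edges_Kmn (m n : nat) (e : {set Kmn m n}) :
  e \in edges (Kmn m n) <-> exists i j, e = Kmn_edge i j.
Proof.
rewrite inE; split=> [/existsP[[i|j]] /existsP[[i'|j']] /andP[// _ /eqP ->]|].
- by exists i, j'.
- by exists i', j; rewrite /Kmn_edge finset.setUC.
- move=> [i [j ->]]; apply/existsP; exists (inl i); apply/existsP.
  by exists (inr j); rewrite /= eqxx.
Qed.

(* Off the edges the value is the junk value [0]. *)
Definition matrix_colouring (m n : nat) (C : 'I_m -> 'I_n -> nat)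
    (e : {set Kmn m n}) : nat :=
  if [pick ij : 'I_m * 'I_n | e == Kmn_edge ij.1 ij.2] is Some ij
  then C ij.1 ij.2 else 0.

Lemma matrix_colouringE (m n : nat) (C : 'I_m -> 'I_n -> nat) i j :
  matrix_colouring C (Kmn_edge i j) = C i j.
Proof.
rewrite /matrix_colouring; case: pickP => [[i' j'] /eqP /Kmn_edge_inj[-> ->] //|].
by move=> /(_ (i, j)); rewrite eqxx.
Qed.

Lemma matrix_list_colouring (m n : nat) (L : {set Kmn m n} -> set nat)
    (C : 'I_m -> 'I_n -> nat) :
  (forall i j, L (Kmn_edge i j) (C i j)) ->
  list_colouring L (matrix_colouring C).
Proof.
by move=> LC e /mem_edges_Kmn[i [j ->]]; rewrite matrix_colouringE; exact: LC.
Qed.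

Lemma Kmn_list_seqs (m n r : nat) (L : {set Kmn m n} -> set nat) :
  edge_list_assignment r L ->
  exists s : 'I_m -> 'I_n -> seq nat,
    [/\ forall i j, uniq (s i j), forall i j, size (s i j) = r &
        forall i j x, x \in s i j -> L (Kmn_edge i j) x].
Proof.
move=> Lr.
have /fin_all_exists[s sP] (ij : 'I_m * 'I_n) : exists s : seq nat,
    [/\ uniq s, size s = r & forall x, x \in s -> L (Kmn_edge ij.1 ij.2) x].
  by apply/card_leII_seq/Lr/mem_edges_Kmn; exists ij.1, ij.2.
by exists (fun i j => s (i, j)); split=> i j; have [] := sP (i, j).
Qed.

Lemma geodesic_size2 (G : sgraph) (x y z : G) :
  x != y -> ~~ adj x y -> adj x z -> adj z y -> geodesic x y [:: z; y].
Proof.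
move=> xy nxy xz zy; split.
  split=> //=; first by rewrite xz zy.
  rewrite !inE !negb_or xy !andbT; apply/andP; split.
    by apply: contraTneq xz => ->; rewrite adj_irrefl.
  by apply: contraTneq zy => ->; rewrite adj_irrefl.
move=> [|a [|b q]] [/= pq _ l] //; first by rewrite l eqxx in xy.
by rewrite andbT l in pq; rewrite pq in nxy.
Qed.

(** Distinct vertices of one class are at distance two, and the two edges of a geodesic are entries
    of their two rows (or columns) at a common position. *)
Lemma matrix_strongly_rainbow (m n : nat) (C : 'I_m -> 'I_n -> nat) :
  (forall i i', i != i' -> exists j, C i j != C i' j) ->
  (forall j j', j != j' -> exists i, C i j != C i j') ->
  strongly_rainbow_connected (matrix_colouring C).
Proof.
move=> rows cols x y.
have [<-|xy] := eqVneq x y; first by exists [::]; split.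
have [axy|naxy] := boolP (adj x y).
  exists [:: y]; split=> //; split; last first.
    by move=> [|a q] // [_ _ /= e]; rewrite e eqxx in xy.
  by split=> //=; rewrite andbT ?inE.
case: x y => [i|j] [i'|j'] // in xy naxy *.
- have [j ij] := rows i i' xy; exists [:: inr j; inl i']; split.
    exact: geodesic_size2.
  rewrite /rainbow /= -/(Kmn_edge i j) [[set inr j; _]]finset.setUC -/(Kmn_edge i' j).
  by rewrite !matrix_colouringE inE ij.
- have [i ij] := cols j j' xy; exists [:: inl i; inr j']; split.
    exact: geodesic_size2.
  rewrite /rainbow /= -/(Kmn_edge i j') [[set inr j; _]]finset.setUC -/(Kmn_edge i j).
  by rewrite !matrix_colouringE inE ij.
Qed.

Lemma rows_separated (m n : nat) (mn : m <= n) (C : 'I_m -> 'I_n -> nat) :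
  (forall i i' : 'I_m, i < i' -> C i' (widen_ord mn i) != C i (widen_ord mn i)) ->
  forall i i', i != i' -> exists j, C i j != C i' j.
Proof.
move=> diag i i'; rewrite -val_eqE neq_ltn => /orP[ii'|ii'].
- by exists (widen_ord mn i); rewrite eq_sym diag.
- by exists (widen_ord mn i'); rewrite diag.
Qed.

Lemma strongly_rainbow_connectedW (G : sgraph) (c : {set G} -> nat) :
  strongly_rainbow_connected c -> rainbow_connected c.
Proof. by move=> sc x y; have [p [[? _] ?]] := sc x y; exists p. Qed.

(** * Upper bound by the root *)

(** Here [t] is the index of the column. If [m <= t], it has no diagonal entry and the full product
    of the lists serves. Otherwise the entries from row [t] down are frozen, and those above it stay
    free. *)
Lemma strong_column_candidates (m r : nat) (t : nat) (s : 'I_m -> seq nat) :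
  (forall i, uniq (s i)) -> (forall i, size (s i) = r) ->
  0 < r -> (1 < m -> 1 < r) -> (m <= t -> t < r ^ m) ->
  exists A : seq {ffun 'I_m -> nat},
    [/\ uniq A, t < size A, forall v, v \in A -> forall i, v i \in s i &
        forall v, v \in A -> forall i k : 'I_m, k = t :> nat -> k < i -> v i != v k].
Proof.
move=> us ss r0 r1 tm; have [mt|tlt] := leqP m t.
  have [A [uA sA Av]] := ffun_product us; exists A; split=> //.
    rewrite sA (eq_bigr (fun=> r)) => [|i _]; last exact: ss.
    by rewrite prod_nat_const card_ord tm.
  by move=> v _ i k kt; have := ltn_ord k; rewrite kt ltnNge mt.
pose k := Ordinal tlt.
have [|x xs _] := @exists_mem_notin _ _ [::] (us k); first by rewrite ss.
(* A row below row [t] exists only if [1 < m], and then lists have at least two colours, so [x] can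
   be avoided. *)
have /fin_all_exists[y yP] (i : 'I_m) : exists y, y \in s i /\ (t < i -> y != x).
  have [ti|_] := ltnP t i; last first.
    by have [|y ys _] := @exists_mem_notin _ _ [::] (us i); [rewrite ss|exists y].
  have [|y ys yx] := @exists_mem_notin _ _ [:: x] (us i); last first.
    by exists y; rewrite inE in yx.
  by rewrite ss r1 // (leq_trans _ (ltn_ord i)) // ltnS (leq_ltn_trans _ ti).
pose S (i : 'I_m) := if i < t then s i else if i == k then [:: x] else [:: y i].
have uS i : uniq (S i) by rewrite /S; case: ifP => // _; case: ifP.
have [A [uA sA Av]] := ffun_product uS; exists A; split=> //.
- apply: leq_trans (ltn_expl t (isT : 1 < 2)) _; rewrite sA.
  have -> : 2 ^ t = \prod_(i < m) (if i < t then 2 else 1).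
    rewrite -big_mkcond -(big_ord_widen _ (fun=> 2)) ?prod_nat_const ?card_ord //.
    exact: ltnW.
  apply: leq_prod => i _; rewrite /S; case: ifP => it; last by case: ifP.
  by rewrite ss r1 // (leq_ltn_trans _ tlt) // (leq_ltn_trans _ it).
- move=> v vA i; have := Av v vA i; rewrite /S; case: ifP => // _.
  case: eqP => [->|_]; rewrite inE => /eqP -> //.
  by have [] := yP i.
- move=> v vA i k' kt; have -> : k' = k by exact: val_inj.
  move=> /= ti; have := Av v vA i; have := Av v vA k.
  rewrite /S /= ltnn eqxx ltnNge (ltnW ti) /= -val_eqE /= gtn_eqF // !inE.
  by move=> /eqP -> /eqP ->; have [_ ->] := yP i.
Qed.

Lemma srcl_upper (m n r : nat) (L : {set Kmn m n} -> set nat) :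
  0 < m -> m <= n -> n <= r ^ m -> edge_list_assignment r L ->
  exists c, list_colouring L c /\ strongly_rainbow_connected c.
Proof.
move=> m0 mn nr /Kmn_list_seqs[s [us ss sL]].
have n0 := leq_trans m0 mn.
have r0 : 0 < r by move: (leq_trans n0 nr); rewrite expn_gt0 gtn_eqF ?orbF.
(* If [1 < m], then [n >= 2], whereas [r = 1] would force [n <= 1]. *)
have r1 : 1 < m -> 1 < r.
  move=> m1; rewrite ltnNge; apply/negP => r1.
  have := leq_trans (leq_trans m1 mn) nr.
  by have -> : r = 1 by [apply/eqP; rewrite eqn_leq r1]; rewrite exp1n.
have /fin_all_exists[A AP] (j : 'I_n) : exists A : seq {ffun 'I_m -> nat},
    [/\ uniq A, j < size A, forall v, v \in A -> forall i, v i \in s i j &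
        forall v, v \in A -> forall i k : 'I_m, k = j :> nat -> k < i -> v i != v k].
  apply: strong_column_candidates => // _.
  exact: leq_trans (ltn_ord j) nr.
have [||f fi fA] := @greedy_distinct_representatives _ n A.
- by move=> j; have [] := AP j.
- by move=> j; have [] := AP j.
exists (matrix_colouring (fun i j => f j i)); split.
  by apply: matrix_list_colouring => i j; have [_ _ As _] := AP j; apply/sL/As.
apply: matrix_strongly_rainbow => [|j j'].
  apply: (@rows_separated _ _ mn (fun i j => f j i)) => i i'.
  by have [_ _ _ Ad] := AP (widen_ord mn i); exact: Ad.
move=> jj'; apply/existsP; apply: contraR jj'; rewrite negb_exists => /forallP e.
by apply/eqP/fi/ffunP => i; apply/eqP; rewrite -[_ == _]negbK.
Qed.

(** * Upper bound by four *)

(** No entry has to avoid more than three colours: row 1 avoids [l] and the colour of row 0, and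
    rows below the diagonal avoid the diagonal colour. Four colours per list suffice. *)
Lemma rainbow_column (m : nat) (i0 i1 : 'I_m) (t : nat) (l : seq nat)
    (s : 'I_m -> seq nat) :
  i0 = 0 :> nat -> i1 = 1 :> nat -> size l <= 2 ->
  (forall i, uniq (s i)) -> (forall i, size (s i) = 4) ->
  exists v : 'I_m -> nat,
    [/\ forall i, v i \in s i,
        forall i k : 'I_m, k = t :> nat -> k < i -> v i != v k,
        v i0 \notin l, v i1 \notin l & v i0 != v i1].
Proof.
move=> e0 e1 sl us ss.
have avoid (i : 'I_m) (a : seq nat) : size a <= 3 -> exists2 x, x \in s i & x \notin a.
  by move=> sa; apply: exists_mem_notin; rewrite ?ss.
have [|x xs xl] := avoid i0 l; first exact: leqW.
have [|y ys] := avoid i1 (x :: l); first by [].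
rewrite inE negb_or => /andP[yx yl].
(* The diagonal colour [z] must agree with [x] or [y] when the diagonal lies in row 0 or 1. *)
have [z [zs z0 z1]] : exists z, [/\ forall k : 'I_m, k = t :> nat -> z \in s k,
    i0 = t :> nat -> z = x & i1 = t :> nat -> z = y].
  have [t0|t0] := eqVneq t 0.
    exists x; split=> // [k|]; last by rewrite e1 t0.
    by rewrite t0 -e0 => /val_inj ->.
  have [t1|t1] := eqVneq t 1.
    exists y; split=> // [k|]; last by rewrite e0 t1.
    by rewrite t1 -e1 => /val_inj ->.
  have [tm|mt] := ltnP t m.
    have [//|z zs _] := avoid (Ordinal tm) [::]; exists z; split.
    - by move=> k kt; have -> : k = Ordinal tm by exact: val_inj.
    - by rewrite e0 => t0'; rewrite -t0' in t0.
    - by rewrite e1 => t1'; rewrite -t1' in t1.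
  (* A column with [m <= t] has no diagonal row, so [0] is a dummy value. *)
  exists 0; split.
  - by move=> k kt; have := ltn_ord k; rewrite kt ltnNge mt.
  - by rewrite e0 => t0'; rewrite -t0' in t0.
  - by rewrite e1 => t1'; rewrite -t1' in t1.
have /fin_all_exists2[w ws wz] (i : 'I_m) : exists2 w, w \in s i & w != z.
  by have [//|w ws wz] := avoid i [:: z]; exists w; rewrite // inE in wz.
have i10 : i1 == i0 = false by rewrite -val_eqE /= e0 e1.
exists (fun i => if i == i0 then x else if i == i1 then y else
  if val i == t then z else w i); split=> /=.
- move=> i; case: eqP => [->|_] //; case: eqP => [->|_] //; case: eqP => // it.
  exact: zs.
- move=> i k kt ki; have -> : (i == i0) = false.
    by apply/eqP => ii; move: ki; rewrite ii e0.
  have -> : val i == t = false by rewrite -kt gtn_eqF.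
  rewrite [val k == t]/= kt eqxx; case: (eqVneq k i0) => [kk|k0] /=.
    by case: (i == i1) => //; rewrite -z0 // -kk.
  have -> : (i == i1) = false.
    apply/eqP => ii; move: ki; rewrite ii e1 ltnS leqn0 => /eqP k0'.
    by move/eqP: k0; apply; apply: val_inj; rewrite /= k0' e0.
  by case: (eqVneq k i1) => [kk|//] /=; rewrite -z1 // -kk.
- by rewrite eqxx.
- by rewrite i10 eqxx.
- by rewrite eqxx i10 eqxx eq_sym.
Qed.

Lemma rcl_upper4 (m n : nat) (L : {set Kmn m n} -> set nat) :
  1 < m -> m <= n -> edge_list_assignment 4 L ->
  exists c, list_colouring L c /\ rainbow_connected c.
Proof.
move=> m1 mn /Kmn_list_seqs[s [us ss sL]].
have m0 := ltnW m1; have n0 := leq_trans m0 mn.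
pose i0 := Ordinal m0; pose i1 := Ordinal m1; pose z := Ordinal n0.
have [] := @rainbow_column m i0 i1 0 [::] (s^~ z) => //.
move=> v [vs vd _ _ v01].
have /fin_all_exists[w wP] (j : 'I_n) := @rainbow_column m i0 i1 j
  [:: v i0; v i1] (s^~ j) erefl erefl isT (us^~ j) (ss^~ j).
pose C i j := if j == z then v i else w j i.
have Cl i j : j != z -> (i == i0) || (i == i1) -> C i j \notin [:: v i0; v i1].
  rewrite /C => /negPf ->; have [_ _ w0 w1 _] := wP j.
  by case/orP => /eqP ->.
have rows i i' : i != i' -> exists j, C i j != C i' j.
  apply: (@rows_separated _ _ mn C) => {}i {}i' ii'; rewrite /C.
  case: (widen_ord mn i =P z) => [e|_]; first exact: vd (congr1 val e) ii'.
  by have [_ wd _ _ _] := wP (widen_ord mn i); exact: wd.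
exists (matrix_colouring C); split.
  apply: matrix_list_colouring => i j; apply: sL; rewrite /C.
  by case: eqP => [-> //|_]; have [ws _ _ _ _] := wP j; exact: ws.
move=> x y.
have [<-|xy] := eqVneq x y; first by exists [::]; split.
have edgeC (i : 'I_m) (j : 'I_n) :
    [set (inr j : Kmn m n); (inl i : Kmn m n)] = Kmn_edge i j.
  by rewrite finset.setUC.
have short (u : Kmn m n) : adj x u -> adj u y ->
    matrix_colouring C [set x; u] != matrix_colouring C [set u; y] ->
    ~~ adj x y -> exists p, gpath x y p /\ rainbow (matrix_colouring C) x p.
  move=> xu uy cu nxy; exists [:: u; y]; split.
    by have [] := geodesic_size2 xy nxy xu uy.
  by rewrite /rainbow /= inE cu.
case: x y => [i|j] [i'|j'] // in xy short *.
- have [j ij] := rows i i' xy; apply: (short (inr j)) => //.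
  by rewrite -/(Kmn_edge i j) edgeC !matrix_colouringE.
- by exists [:: inr j'].
- by exists [:: inl i'].
have {}short i : C i j != C i j' ->
    exists p, gpath (inr j : Kmn m n) (inr j') p /\
      rainbow (matrix_colouring C) (inr j : Kmn m n) p.
  move=> ij; apply: (short (inl i)) => //.
  by rewrite -/(Kmn_edge i j') edgeC !matrix_colouringE.
have vC : v =1 C^~ z by move=> i; rewrite /C eqxx.
(* If one end is [z], the columns already differ in row 0, because the other column avoids [v i0]
   there. *)
have [ejz|jz] := eqVneq j z.
  have j'z : j' != z by rewrite -ejz eq_sym.
  apply: (short i0); rewrite ejz -vC; apply: contraNneq (Cl i0 _ j'z _) => // <-.
  by rewrite !inE eqxx.
have [ejz|j'z] := eqVneq j' z.
  apply: (short i0); rewrite ejz -vC; apply: contraNneq (Cl i0 _ jz _) => // ->.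
  by rewrite !inE eqxx.
(* Agreement in row 1 is enough for the detour: the last edge then has colour [C i1 j], which
   differs from the first colour [C i0 j]. *)
have [e1|] := eqVneq (C i1 j) (C i1 j'); last exact: short.
exists [:: inl i0; inr z; inl i1; inr j']; split.
  split=> //=; rewrite !inE !negb_or /= andbT.
  by rewrite -[inr j == inr z]/(j == z) jz -[inr j == inr j']/(j == j') xy
     -[inr z == inr j']/(z == j') eq_sym j'z.
rewrite /rainbow /= edgeC -/(Kmn_edge i0 z) edgeC -/(Kmn_edge i1 j').
rewrite !matrix_colouringE -!vC -e1.
have := Cl i0 j jz isT; have := Cl i1 j jz isT; rewrite !inE !negb_or.
move=> /andP[a b] /andP[c d].
rewrite c d v01 /= andbT eq_sym in a *; rewrite a [v i1 == _]eq_sym b !andbT.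
by rewrite /C (negPf jz); have [_ _ _ _] := wP j.
Qed.

(** * Lower bounds from constant lists *)

Lemma size_rainbow_leq (G : sgraph) (c : {set G} -> nat) (r : nat) x y p :
  (forall e, e \in edges G -> c e < r) -> gpath x y p -> rainbow c x p ->
  size p <= r.
Proof.
move=> cr [xp _ _] rp.
have -> : size p = size (map c (path_edges x p)) by rewrite size_map size_pairmap.
rewrite -(size_iota 0 r); apply: uniq_leq_size => // _ /mapP[e ep ->].
rewrite mem_iota add0n; apply: cr.
elim: p x xp ep {rp} => //= a p IHp x /andP[xa ap]; rewrite inE => /predU1P[->|].
  by rewrite inE; apply/existsP; exists x; apply/existsP; exists a; rewrite xa eqxx.
exact: IHp.
Qed.

(** Paths within one class have even length, so at most 3 means 0 or 2. A rainbow path of length 2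
    through row [i] shows that the columns differ there; hence columns inject into the [r ^ m]
    possible ones. *)
Lemma short_rainbow_bound (m n r : nat) (c : {set Kmn m n} -> nat) :
  (forall e, e \in edges (Kmn m n) -> c e < r) ->
  (forall j j' : 'I_n, exists p : seq (Kmn m n),
    [/\ gpath (inr j : Kmn m n) (inr j') p, rainbow c (inr j : Kmn m n) p &
        size p <= 3]) ->
  n <= r ^ m.
Proof.
move=> cr conn.
have cij i j : c (Kmn_edge i j) < r by apply/cr/mem_edges_Kmn; exists i, j.
pose F (j : 'I_n) := [ffun i : 'I_m => Ordinal (cij i j)].
suff /leq_card : injective F by rewrite card_ffun !card_ord.
move=> j j' /ffunP Fj; have [p [[pp _ lp] rp sp]] := conn j j'.
case: p => [|[i|//] [|[//|k] [|[i'|//] [|//]]]] //= in pp lp rp sp *.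
  by case: lp.
case: lp rp => ->; rewrite /rainbow /= -/(Kmn_edge i j') [[set inr j; _]]finset.setUC.
rewrite -/(Kmn_edge i j) inE => /andP[/eqP[]].
by have := Fj i; rewrite !ffunE => /(congr1 val).
Qed.

(** Rainbow paths have length at most 3: for [r <= 3] by counting colours, and for [m = 1] because a
    longer path would visit the centre of the star twice. *)
Lemma rcl_const_list (m n r : nat) :
  (forall L : {set Kmn m n} -> set nat, edge_list_assignment r L ->
    exists c : {set Kmn m n} -> nat, list_colouring L c /\ rainbow_connected c) ->
  r <= 3 \/ m = 1 -> n <= r ^ m.
Proof.
move=> H rm; have [|c [cr rc]] := H (fun=> `I_r); first by move=> e _; exact: card_lexx.
apply: (@short_rainbow_bound _ _ _ c) => // j j'.
have [p [gp rp]] := rc (inr j) (inr j'); exists p; split=> //.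
case: rm => [r3|m1]; first exact: leq_trans (size_rainbow_leq cr gp rp) r3.
subst m; case: gp => + + _.
case: p {rp} => [|[i|//] [|[//|k] [|[i'|//] p]]] //= _.
by rewrite (ord1 i) (ord1 i') !inE eqxx !orbT /= andbF.
Qed.

Lemma srcl_const_list (m n r : nat) : 0 < m ->
  (forall L : {set Kmn m n} -> set nat, edge_list_assignment r L ->
    exists c : {set Kmn m n} -> nat,
      list_colouring L c /\ strongly_rainbow_connected c) ->
  n <= r ^ m.
Proof.
move=> m0 H; have [|c [cr rc]] := H (fun=> `I_r); first by move=> e _; exact: card_lexx.
apply: (@short_rainbow_bound _ _ _ c) => // j j'.
have [p [[gp mp] rp]] := rc (inr j) (inr j'); exists p; split=> //.
have [ejj|jj'] := eqVneq j j'.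
  by apply: leq_trans (mp [::] _) _ => //; rewrite ejj; split.
apply: leq_trans (mp [:: inl (Ordinal m0); inr j'] _) _ => //.
by have [] := @geodesic_size2 (Kmn m n) (inr j) (inr j') (inl (Ordinal m0)).
Qed.

Theorem theorem3p12 (R : realType) (m n : nat) (hm : 1 <= m) (hmn : m <= n) :
  ((m = 1 -> is_rcl (Kmn m n) n) /\
   (2 <= m -> is_rcl (Kmn m n) (minn (ceil_root R m n) 4))) /\
  is_srcl (Kmn m n) (ceil_root R m n).
Proof.
have srcl r L := @srcl_upper m n r L hm hmn.
have rcl r L : n <= r ^ m -> edge_list_assignment r L ->
    exists c : {set Kmn m n} -> nat, list_colouring L c /\ rainbow_connected c.
  move=> nr Lr; have [c [Lc sc]] := srcl r L nr Lr.
  by exists c; split=> //; exact: strongly_rainbow_connectedW.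
have nk : n <= ceil_root R m n ^ m by rewrite -(ceil_root_leq R) // leqnn.
split; [split=> [m1|m2]; split|split].
- by move=> L; apply: rcl; rewrite m1 expn1.
- by move=> r /rcl_const_list; rewrite m1 expn1; apply; right.
- move=> L; rewrite /minn; case: ifP => _; first exact: rcl.
  exact: rcl_upper4.
(* From [r = 4] on the minimum is bounded by its second argument, so constant lists only have to
   handle [r <= 3]. *)
- move=> r H; rewrite geq_min; case: (ltnP 3 r) => [_|r3]; first by rewrite orbT.
  by rewrite ceil_root_leq // (rcl_const_list H) //; left.
- by move=> L; exact: srcl.
- by move=> r /srcl_const_list; rewrite ceil_root_leq //; apply.
Qed.
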